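(* Let $0<a\le b$, let customer valuations be uniform on $[0,a]$, i.e. $F(p)=p/a$ for $p\in[0,a]$, and let historical prices have density $g(p)=1/b$ on $[0,b]$. Let $R(p)=p(1-F(p))$, and let $p^*\in\arg\max_{p\ge0}p\int_p^\infty g(x)(1-F(x))\,dx$ be the asymptotic optimal model-free price. Suppose that at each historical price only a fraction $z$ with $0\le z<0.25$ of the non-purchasing customers is recorded in the data, and let $p_z$ be the model-based optimal price estimated from the censored data, i.e. a maximizer over $[0,a)$ of $$p\cdot\frac{1-F(p)}{1-F(p)+zF(p)} .$$ Then $R(p^* )>R(p_z)$, i.e. $p^*$ generates a strictly higher revenue than the model-based optimal price estimated from the censored data.
   Context: Single product; $F$ is the CDF of customer valuations and $R(p)$ is the true expected revenue at price $p$. If only a fraction $z$ of non-purchasing customers is recorded at each price, the asymptotic purchase probability at price $p$ estimated from the censored data is $\frac{1-F(p)}{1-F(p)+zF(p)}$, and the model-based approach maximizes $p$ times this estimated probability. *)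

(* Defs.v *)
From HB Require Import structures.
From mathcomp Require Import all_boot all_order all_algebra.
From mathcomp Require Import all_classical all_reals all_analysis.

Set Implicit Arguments.
Unset Strict Implicit.
Unset Printing Implicit Defensive.

Import Order.TTheory GRing.Theory Num.Theory.
Import numFieldNormedType.Exports.

Local Open Scope classical_set_scope.
Local Open Scope ring_scope.

Definition is_argmax {T : Type} {R : realType} (D : set T) (f : T -> R) (x : T)
  : Prop := D x /\ forall y, D y -> f y <= f x.

(* [cdf] takes values in [\bar R]; it is a probability, hence finite. *)
Definition real_cdf {d : measure_display} {T : measurableType d} {R : realType}
  {P : probability T R} (V : {RV P >-> R}) (p : R) : R := fine (cdf V p).

Definition revenue {R : realType} (F : R -> R) (p : R) : R := p * (1 - F p).

(* Asymptotic model-free objective when historical prices have density [g]: a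
   purchase recorded at a historical price x >= p is credited p. *)
Definition model_free_objective {R : realType} (F g : R -> R) (p : R) : R :=
  p * \int[@lebesgue_measure R]_(x in `[p, +oo[) (g x * (1 - F x)).

(* Limiting share of purchases among the recorded customers when all purchases
   but only a fraction [z] of the non-purchases are recorded. *)
Definition censored_purchase_prob {R : realType} (F : R -> R) (z p : R) : R :=
  (1 - F p) / (1 - F p + z * F p).

Definition model_based_objective {R : realType} (F : R -> R) (z p : R) : R :=
  p * censored_purchase_prob F z p.

(* Main.v *)
Require Import Defs.
From mathcomp Require Import all_boot all_order all_algebra.
From mathcomp Require Import all_classical all_reals all_analysis.
From mathcomp Require Import ring lra.

Import Order.TTheory GRing.Theory Num.Theory.
Import numFieldNormedType.Exports.

Local Open Scope classical_set_scope.
Local Open Scope ring_scope.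

(** A price [u a] has revenue [a u (1 - u)], a parabola symmetric about
    [u = 1/2].  The model-free price is [u = 1/3], with the same revenue as
    [u = 2/3]; the model-based price lies strictly above [2/3], on the
    decreasing branch, and so earns less.

    The model-free objective is [p (a - p)^2 / (2 a b)] for [0 <= p <= a] and
    vanishes beyond ([model_free_objective_uniform]).  Its only maximizer is
    [a / 3], because [4/27 - u (1 - u)^2 = (u - 1/3)^2 (4/3 - u)]
    ([model_free_argmax_uniform]).

    The model-based objective is, up to the factor [a],
    [h u = u (1 - u) / (1 - c u)] with [c = 1 - z], and [h y - h u] has the sign
    of [(y - u) (1 - y - u + c u y)].  When [z < 1/4] there is a single
    [y > 2/3] for which the second factor is positive for every [u <= 2/3]; this
    [y] beats all those prices at once, so every maximizer exceeds [2/3]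
    ([model_based_argmax_uniform]).  Comparing with one explicit price replaces
    the computation of the critical point [1 / (1 + sqrt z)], and treats [z = 0]
    together with [z > 0]. *)

Lemma real_cdf_uniform {R : realType} {d : measure_display}
    {T : measurableType d} {P : probability T R} {V : {RV P >-> R}}
    {a : R} (a_gt0 : 0 < a)
    (V_uniform : forall A : set R, measurable A ->
       distribution P V A = uniform_prob a_gt0 A) (p : R) :
  0 <= p -> real_cdf V p = Num.min p a / a.
Proof.
move=> p0; rewrite /real_cdf /cdf V_uniform// /uniform_prob integral_uniform_pdf.
have -> : `]-oo, p] `&` `[0, a] = `[0, Num.min p a]%classic.
  apply/seteqP; split => x /=; rewrite !in_itv /= le_min.
    by case=> -> /andP[-> ->].
  by move=> /andP[-> /andP[-> ->]].
rewrite (eq_integral (fun=> (a^-1)%:E)); last first.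
  move=> x; rewrite inE /= in_itv /= le_min => /and3P[x0 _ xa].
  by rewrite /uniform_pdf x0 xa subr0.
rewrite integral_cst//= lebesgue_measure_itv /= lte_fin.
have m0 : 0 <= Num.min p a by rewrite le_min p0 ltW.
case: ltP => [_|m_le0].
  by rewrite -EFinB -EFinM /= subr0 mulrC.
have -> : Num.min p a = 0 by apply/eqP; rewrite eq_le m_le0.
by rewrite mule0 mul0r.
Qed.

Lemma Rintegral_linear_tail {R : realType} (a k p : R) : p < a ->
  \int[@lebesgue_measure R]_(x in `[p, a]) (k * (a - x)) =
  k * (a - p) ^+ 2 / 2.
Proof.
move=> pa; pose G : R -> R := fun x => - k / 2 * (a - x) ^+ 2.
have dG (x : R) : is_derive x (1 : R) G (k * (a - x)).
  rewrite /G; apply: is_derive_eq.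
  by rewrite /GRing.scale /=; field.
have cG (x : R) : {for x, continuous G}.
  by apply/differentiable_continuous/derivable1_diffP; exact: ex_derive.
rewrite /Rintegral (@continuous_FTC2 _ _ G)//=.
- by rewrite /G; field.
- apply: continuous_in_subspaceT => x _.
  by apply: cvgM; [exact: cvg_cst | apply: cvgB; [exact: cvg_cst | exact: cvg_id]].
- split=> [x _||]; first exact: ex_derive.
  + by apply: cvg_at_right_filter; exact: cG.
  + by apply: cvg_at_left_filter; exact: cG.
- by move=> x _; rewrite derive1E; exact: derive_val.
Qed.

(** The demand [1 - F] vanishes beyond [a], so the tail integral is one of a
    linear function over [[p, a]], where the density is constantly [1 / b] since
    [a <= b]. *)
Lemma model_free_objective_uniform {R : realType} {F : R -> R} {a b p : R} :
    0 < a -> a <= b -> (forall x, 0 <= x -> F x = Num.min x a / a) -> 0 <= p ->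
  model_free_objective F (uniform_pdf 0 b) p =
  p * (a - Num.min p a) ^+ 2 / (2 * a * b).
Proof.
move=> a0 ab FE p0; have b0 : 0 < b by exact: lt_le_trans ab.
rewrite /model_free_objective.
have F1 x : a <= x -> 1 - F x = 0.
  move=> ax; rewrite FE; last by rewrite (le_trans _ ax) ?ltW.
  by rewrite min_r// divff ?subrr ?gt_eqF.
case: (ltP p a) => pa; last first.
  rewrite (@eq_Rintegral _ _ _ _ _ (fun=> 0)); last first.
    move=> x; rewrite inE /= in_itv /= andbT => px.
    by rewrite F1 ?mulr0// (le_trans pa).
  by rewrite /Rintegral integral0 /= mulr0 subrr expr0n /= mulr0 mul0r.
pose linear_part : R -> R := (fun x => (a * b)^-1 * (a - x)) \_ `[p, a].
rewrite (@eq_Rintegral _ _ _ lebesgue_measure _ linear_part); last first.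
  move=> x; rewrite inE /= in_itv /= andbT => px.
  have x0 : 0 <= x by exact: le_trans px.
  rewrite /linear_part patchE; case: ifPn => [|].
    rewrite inE /= in_itv /= => /andP[_ xa].
    rewrite FE// min_l// /uniform_pdf x0 (le_trans xa ab) /= subr0.
    by field; rewrite !gt_eqF.
  rewrite notin_setE /= in_itv /= px /= => /negP; rewrite -ltNge => /ltW ax.
  by rewrite F1// mulr0.
rewrite /linear_part -Rintegral_mkcondr setIidr; last first.
  by move=> x /=; rewrite !in_itv /= => /andP[->].
by rewrite Rintegral_linear_tail//; field; rewrite !gt_eqF.
Qed.

Lemma model_free_argmax_uniform {R : realType} {F : R -> R} {a b p : R} :
    0 < a -> a <= b -> (forall x, 0 <= x -> F x = Num.min x a / a) ->
    is_argmax `[0, +oo[ (model_free_objective F (uniform_pdf 0 b)) p ->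
  p = a / 3.
Proof.
move=> a0 ab FE [+ /(_ (a / 3))].
rewrite /= !in_itv /= !andbT => p0.
have b0 : 0 < b by exact: lt_le_trans ab.
have a30 : 0 <= a / 3 by rewrite divr_ge0 ?ltW.
move=> /(_ a30); rewrite !(model_free_objective_uniform a0 ab FE)//.
rewrite ler_pM2r ?invr_gt0 ?mulr_gt0// (min_l (x := a / 3)); last by lra.
have a3_gt0 : 0 < a ^+ 3 by rewrite exprn_gt0.
have value_a3 : a / 3 * (a - a / 3) ^+ 2 = 4 / 27 * a ^+ 3 by field.
rewrite value_a3; case: (ltP p a) => [pa|_]; last by rewrite subrr; lra.
move=> Hp.
(* [a / 3] is a double root of the gap to the maximum. *)
have gap : 4 / 27 * a ^+ 3 - p * (a - p) ^+ 2 =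
  (p - a / 3) ^+ 2 * (4 / 3 * a - p) by field.
have : (p - a / 3) ^+ 2 * (4 / 3 * a - p) <= 0 by rewrite -gap subr_le0.
rewrite pmulr_lle0 ?subr_gt0; last by lra.
by move=> sq_le0; apply/eqP; rewrite -subr_eq0 -sqrf_eq0 eq_le sq_le0 sqr_ge0.
Qed.

Lemma model_based_argmax_uniform {R : realType} {F : R -> R} {a z p : R} :
    0 < a -> 0 <= z -> z < 1 / 4 ->
    (forall x, 0 <= x -> F x = Num.min x a / a) ->
    is_argmax `[0, a[ (model_based_objective F z) p ->
  2 / 3 * a < p.
Proof.
move=> a0 z0 z4 FE [+ pmax]; rewrite /= in_itv /= => /andP[p0 pa].
rewrite ltNge; apply/negP => p_le.
have objE x : 0 <= x < 1 -> model_based_objective F z (x * a) =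
    a * (x * (1 - x) / (1 - x + z * x)).
  move=> /andP[x0 x1].
  rewrite /model_based_objective /censored_purchase_prob FE; last first.
    by rewrite mulr_ge0// ltW.
  rewrite min_l; last by rewrite ler_piMl ?ltW.
  by rewrite mulfK ?gt_eqF//; ring.
have [u pE] : exists u, p = u * a by exists (p / a); rewrite divfK ?gt_eqF.
move: p0 pa p_le pmax; rewrite {}pE ler_pM2r// pmulr_lge0//.
rewrite -[X in _ < X]mul1r ltr_pM2r// => u0 u1 u_le.
(* At [u = 2/3], the factor [1 - y - u + (1 - z) u y] is positive exactly when
   [y < 1 / (1 + 2 z)], a bound above [2/3] as [z < 1/4]; the affine
   [y = 2/3 + (1/4 - z) / 2] lies between the two. *)
pose y : R := 19 / 24 - z / 2.
have y1 : y < 1 by rewrite /y; lra.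
have y23 : 2 / 3 < y by rewrite /y; lra.
have y_dom : `[0, a[%classic (y * a).
  by rewrite /= in_itv /= mulr_ge0 ?(ltW a0) ?gtr_pMl//=; lra.
move=> /(_ _ y_dom).
have zu0 : 0 <= z * u by rewrite mulr_ge0.
have zy0 : 0 <= z * y by rewrite mulr_ge0//; lra.
rewrite !objE; [|lra..].
rewrite ler_pM2l// ler_pdivrMr; last by lra.
rewrite mulrAC ler_pdivlMr; last by lra.
apply/negP; rewrite -ltNge -subr_gt0.
have -> : y * (1 - y) * (1 - u + z * u) - u * (1 - u) * (1 - y + z * y) =
  (y - u) * (1 - y - u * (1 - (1 - z) * y)) by ring.
have slope : 0 <= 1 - (1 - z) * y by lra.
have at_two_thirds : u * (1 - (1 - z) * y) <= 2 / 3 * (1 - (1 - z) * y).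
  exact: ler_wpM2r.
have : 0 < 1 - y - 2 / 3 * (1 - (1 - z) * y) by rewrite /y; nra.
by move=> ?; apply: mulr_gt0; lra.
Qed.

Theorem mainTheorem7 (R : realType) (d : measure_display)
    (T : measurableType d) (P : probability T R) (V : {RV P >-> R})
    (a b z pstar pz : R) (a_gt0 : 0 < a) (a_le_b : a <= b)
    (V_uniform : forall A : set R, measurable A ->
       distribution P V A = uniform_prob a_gt0 A)
    (z_ge0 : 0 <= z) (z_lt : z < 1 / 4)
    (pstar_opt : is_argmax `[0, +oo[
       (model_free_objective (real_cdf V) (uniform_pdf 0 b)) pstar)
    (pz_opt : is_argmax `[0, a[ (model_based_objective (real_cdf V) z) pz) :
  revenue (real_cdf V) pz < revenue (real_cdf V) pstar.
Proof.
have FE := real_cdf_uniform a_gt0 V_uniform.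
have pz_gt := model_based_argmax_uniform a_gt0 z_ge0 z_lt FE pz_opt.
have := pz_opt.1; rewrite /= in_itv /= => /andP[pz_ge0 pz_lt].
rewrite (model_free_argmax_uniform a_gt0 a_le_b FE pstar_opt) /revenue.
rewrite !FE//; last by lra.
rewrite !min_l; [|lra..].
rewrite -(ltr_pM2r a_gt0).
have scaledE (x : R) : x * (1 - x / a) * a = x * (a - x).
  by field; rewrite gt_eqF.
rewrite !scaledE -subr_gt0.
have -> : a / 3 * (a - a / 3) - pz * (a - pz) =
  (pz - a / 3) * (pz - 2 / 3 * a) by field.
by apply: mulr_gt0; lra.
Qed.
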